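(* Let $m\ge1$ be an integer. For every integer $k\ge 1$, the insertion algorithm $\kappa\mapsto T(\kappa)$ restricts to a bijection from the set of cyclic compositions with first component $k$ all of whose contiguous differences satisfy $k_{i+1}-k_i\le m$, onto the set of $\overline{\Pi}_m$-enriched shift-plethystic trees with root color $k$ (the trees whose words form $\sigma^k\mathscr{A}_{\overline{\Pi}_m}$). Moreover, $$\mathscr{C}^{(m)}=\overline{\Pi}_\infty\circ_s\mathscr{A}_{\overline{\Pi}_m}.$$
   Context: $\mathbb{K}$ is a field of characteristic zero, $\mathbb{X}=\{X_0,X_1,X_2,\dots\}$, and $\mathbb{K}\langle\langle\mathbb{X}\rangle\rangle$ is the algebra of noncommutative formal power series in $\mathbb{X}$. For $\kappa=(k_1,\dots,k_\ell)\in\mathbb{N}^\ell$ ($\mathbb{N}\ni 0$) write $X_\kappa=X_{k_1}\cdots X_{k_\ell}$ (empty word $=1$) and $\langle R,X_\kappa\rangle$ for the coefficient of $X_\kappa$ in $R$. Convergence of series is coefficientwise eventual stabilization. Shift: $\sigma$ is the continuous algebra endomorphism with $\sigma X_i=X_{i+1}$. Shift-plethysm: for $S$ with zero constant term, $R\circ_s S=\sum_{\kappa}\langle R,X_\kappa\rangle(\sigma^{k_1}S)(\sigma^{k_2}S)\cdots(\sigma^{k_\ell}S)$. A composition is a finite sequence of positive integers. $\mathscr{C}^{(m)}$ is the sum of the words $X_\kappa$ over all compositions $\kappa=(k_1,\dots,k_\ell)$, $\ell\ge 0$, with $k_{i+1}-k_i\le m$ for $1\le i<\ell$. A composition $\kappa=(k_1,\dots,k_\ell)$,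 $\ell\ge1$, is cyclic if $k_1<k_i$ for all $1<i\le\ell$. $\overline{\Pi}_m=(1-X_m)^{-1}(1-X_{m-1})^{-1}\cdots(1-X_1)^{-1}$ and $\overline{\Pi}_\infty=\lim_{m\to\infty}\overline{\Pi}_m$ (so $\overline{\Pi}_m$, resp. $\overline{\Pi}_\infty$, is the sum of $X_\mu$ over all weakly decreasing sequences $\mu$ of positive integers with parts at most $m$, resp. with no bound). $\mathscr{A}_{\overline{\Pi}_m}$ is the unique series with zero constant term satisfying $\mathscr{A}_{\overline{\Pi}_m}=X_0\,(\overline{\Pi}_m\circ_s\mathscr{A}_{\overline{\Pi}_m})$. $\overline{\Pi}_m$-enriched shift-plethystic trees with root color $k$: rooted plane trees with vertices colored by natural numbers, root colored $k$, such that for every internal vertex of color $c$ whose children have, from left to right, colors $c_1,\dots,c_r$, the sequence $(c_1-c,\dots,c_r-c)$ is weakly decreasing with all entries in $\{1,\dots,m\}$. The word of a tree is $X_{\kappa}$ with $\kappa$ the sequence of colors read in preorder; $\sigma^k\mathscr{A}_{\overline{\Pi}_m}$ is the sum of the words of all these trees. Insertion algorithm: given a cyclic composition $\kappa=(k_1,\dots,k_\ell)$, let $T_1$ be the one-vertex tree with label $k_1$. Given $T_j$ ($1\le j<\ell$), traverse the rightmost branch of $T_j$ from leaf to root until the first vertex whose label is strictly less than $k_{j+1}$ (it exists since the root label is less than $k_{j+1}$), and attach a new vertex labeled $k_{j+1}$ as its rightmost child, obtaining $T_{j+1}$. Set $T(\kappa)=T_\ell$. *)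

(* Defs.v *)
From HB Require Import structures.
From mathcomp Require Import all_boot all_order all_algebra.
From mathcomp Require Import mathcomp_extra boolp classical_sets functions.
From mathcomp Require Import cardinality fsbigop.

Set Implicit Arguments.
Unset Strict Implicit.
Unset Printing Implicit Defensive.

Import GRing.Theory.
Local Open Scope classical_set_scope.
Local Open Scope ring_scope.

(* A series in the noncommuting indeterminates X_0, X_1, ... is the function
   sending a word (the sequence of its indices) to its coefficient. *)
Definition ncseries (K : Type) : Type := seq nat -> K.

HB.instance Definition _ (K : Type) := gen_eqMixin (ncseries K).
HB.instance Definition _ (K : Type) := gen_choiceMixin (ncseries K).

Section SeriesAlgebra.
Variable K : fieldType.
Implicit Types (R S T : ncseries K) (w : seq nat) (a : K).

Definition nc_zero : ncseries K := fun _ => 0.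
Definition nc_opp R : ncseries K := fun w => - R w.
Definition nc_add R S : ncseries K := fun w => R w + S w.
Definition nc_scale a R : ncseries K := fun w => a * R w.
Definition nc_one : ncseries K := fun w => (w == [::])%:R.
Definition nc_mul R S : ncseries K :=
  fun w => \sum_(i < (size w).+1) R (take i w) * S (drop i w).

Lemma nc_addA : associative nc_add.
Proof. by move=> R S T; apply/funext => w; exact: addrA. Qed.
Lemma nc_addC : commutative nc_add.
Proof. by move=> R S; apply/funext => w; exact: addrC. Qed.
Lemma nc_add0 : left_id nc_zero nc_add.
Proof. by move=> R; apply/funext => w; exact: add0r. Qed.
Lemma nc_addN : left_inverse nc_zero nc_opp nc_add.
Proof. by move=> R; apply/funext => w; exact: addNr. Qed.

HB.instance Definition _ :=
  GRing.isZmodule.Build (ncseries K) nc_addA nc_addC nc_add0 nc_addN.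

Definition nc_deriv (x : nat) R : ncseries K := fun w => R (x :: w).

Lemma nc_mul_nil R S : nc_mul R S [::] = R [::] * S [::].
Proof. by rewrite /nc_mul big_ord_recl big_ord0 addr0. Qed.

Lemma nc_mul_cons R S x w :
  nc_mul R S (x :: w) = R [::] * S (x :: w) + nc_mul (nc_deriv x R) S w.
Proof. by rewrite /nc_mul big_ord_recl. Qed.

Lemma nc_deriv_mul x R S : nc_deriv x (nc_mul R S) =
  nc_add (nc_scale (R [::]) (nc_deriv x S)) (nc_mul (nc_deriv x R) S).
Proof. by apply/funext => w; rewrite /nc_deriv nc_mul_cons. Qed.

Lemma nc_mulDl : left_distributive nc_mul nc_add.
Proof.
move=> R S T; apply/funext => w; rewrite /nc_mul /nc_add -big_split.
by apply: eq_bigr => i _; rewrite mulrDl.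
Qed.

Lemma nc_mulDr : right_distributive nc_mul nc_add.
Proof.
move=> R S T; apply/funext => w; rewrite /nc_mul /nc_add -big_split.
by apply: eq_bigr => i _; rewrite mulrDr.
Qed.

Lemma nc_scaleAl a R S : nc_scale a (nc_mul R S) = nc_mul (nc_scale a R) S.
Proof.
apply/funext => w; rewrite /nc_mul /nc_scale mulr_sumr /=.
by apply: eq_bigr => i _; rewrite mulrA.
Qed.

Lemma nc_scaleAr a R S : nc_scale a (nc_mul R S) = nc_mul R (nc_scale a S).
Proof.
apply/funext => w; rewrite /nc_mul /nc_scale mulr_sumr /=.
by apply: eq_bigr => i _; rewrite mulrCA.
Qed.

Lemma nc_mulA : associative nc_mul.
Proof.
move=> R S T; apply/funext => w; elim: w R => [|x w IHw] R.
  by rewrite !nc_mul_nil mulrA.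
rewrite !nc_mul_cons IHw nc_deriv_mul nc_mulDl -nc_scaleAl nc_mul_nil.
by rewrite mulrDr mulrA -addrA.
Qed.

Lemma nc_mul1 : left_id nc_one nc_mul.
Proof.
move=> R; apply/funext => w; rewrite /nc_mul big_ord_recl big1 /=.
  by rewrite take0 drop0 /nc_one eqxx mul1r addr0.
move=> i _; rewrite /nc_one; case: w i => [|x w] i; first by case: i.
by rewrite /= mul0r.
Qed.

Lemma nc_mulr1 : right_id nc_one nc_mul.
Proof.
move=> R; apply/funext => w; rewrite /nc_mul big_ord_recr big1 /=.
  by rewrite take_size drop_size /nc_one eqxx mulr1 add0r.
move=> i _; rewrite /nc_one -size_eq0 size_drop subn_eq0 leqNgt ltn_ord.
by rewrite mulr0.
Qed.

Lemma nc_oner_neq0 : nc_one != 0.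
Proof.
apply/eqP => /(congr1 (fun R : ncseries K => R [::])).
by move/eqP; rewrite [X in X == _]/nc_one eqxx oner_eq0.
Qed.

HB.instance Definition _ := GRing.Zmodule_isNzRing.Build (ncseries K)
  nc_mulA nc_mul1 nc_mulr1 nc_mulDl nc_mulDr nc_oner_neq0.

Lemma nc_scaleA a b R : nc_scale a (nc_scale b R) = nc_scale (a * b) R.
Proof. by apply/funext => w; exact: mulrA. Qed.
Lemma nc_scale1 : left_id 1 nc_scale.
Proof. by move=> R; apply/funext => w; exact: mul1r. Qed.
Lemma nc_scaleDr : right_distributive nc_scale +%R.
Proof. by move=> a R S; apply/funext => w; exact: mulrDr. Qed.
Lemma nc_scaleDl R : {morph nc_scale^~ R : a b / a + b}.
Proof. by move=> a b; apply/funext => w; exact: mulrDl. Qed.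

HB.instance Definition _ := GRing.Zmodule_isLmodule.Build K (ncseries K)
  nc_scaleA nc_scale1 nc_scaleDr nc_scaleDl.
HB.instance Definition _ :=
  GRing.Lmodule_isLalgebra.Build K (ncseries K) nc_scaleAl.
HB.instance Definition _ :=
  GRing.Lalgebra_isAlgebra.Build K (ncseries K) nc_scaleAr.

Definition nc_unit : pred (ncseries K) :=
  fun R => `[< exists S, S * R = 1 /\ R * S = 1 >].

Definition nc_inv R : ncseries K := xget R [set S | S * R = 1 /\ R * S = 1].

Lemma nc_invP R : nc_unit R -> nc_inv R * R = 1 /\ R * nc_inv R = 1.
Proof. by move=> /asboolP exS; exact: (xgetPex R exS). Qed.

Lemma nc_mulVr : {in nc_unit, left_inverse 1 nc_inv *%R}.
Proof. by move=> R /nc_invP[]. Qed.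
Lemma nc_divrr : {in nc_unit, right_inverse 1 nc_inv *%R}.
Proof. by move=> R /nc_invP[]. Qed.
Lemma nc_unitrP R S : S * R = 1 /\ R * S = 1 -> nc_unit R.
Proof. by move=> SR; apply/asboolP; exists S. Qed.
Lemma nc_invr_out : {in [predC nc_unit], nc_inv =1 id}.
Proof.
by move=> R /asboolPn nuR; apply: xgetPN => S SR; apply: nuR; exists S.
Qed.

HB.instance Definition _ := GRing.NzRing_hasMulInverse.Build (ncseries K)
  nc_mulVr nc_divrr nc_unitrP nc_invr_out.

End SeriesAlgebra.

Section Series.
Variable K : fieldType.
Implicit Types (R S : ncseries K) (w kappa : seq nat).

Lemma nc0E w : (0 : ncseries K) w = 0. Proof. by []. Qed.
Lemma nc1E w : (1 : ncseries K) w = (w == [::])%:R. Proof. by []. Qed.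
Lemma ncDE R S w : (R + S) w = R w + S w. Proof. by []. Qed.
Lemma ncNE R w : (- R) w = - R w. Proof. by []. Qed.
Lemma ncZE a R w : (a *: R) w = a * R w. Proof. by []. Qed.
Lemma ncME R S w :
  (R * S) w = \sum_(i < (size w).+1) R (take i w) * S (drop i w).
Proof. by []. Qed.
Lemma ncM_nil R S : (R * S) [::] = R [::] * S [::].
Proof. exact: nc_mul_nil. Qed.

Definition ncvar (k : nat) : ncseries K := fun w => (w == [:: k])%:R.

Definition ncword kappa : ncseries K := \prod_(k <- kappa) ncvar k.

Lemma ncvarM_cons k S x w : (ncvar k * S) (x :: w) = (x == k)%:R * S w.
Proof.
rewrite [LHS]nc_mul_cons /ncvar /= mul0r add0r.
rewrite -[in RHS](mul1r S) ncME mulr_sumr; apply: eq_bigr => i _.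
by rewrite /nc_deriv nc1E mulrA -natrM mulnb eqseq_cons.
Qed.

Lemma ncvarM_nil k S : (ncvar k * S) [::] = 0.
Proof. by rewrite ncM_nil /ncvar mul0r. Qed.

Lemma ncwordE kappa w : ncword kappa w = (w == kappa)%:R.
Proof.
elim: kappa w => [|k kappa IH] [|x w]; rewrite /ncword ?big_nil ?big_cons //.
  by rewrite ncvarM_nil.
by rewrite ncvarM_cons [X in _ * X]IH -natrM mulnb eqseq_cons.
Qed.

(* The sum of a possibly infinite family of series, for coefficientwise
   eventual stabilization. It is meaningful for summable families; the
   coefficients receiving infinitely many nonzero contributions are 0. *)
Definition ncsum (I : choiceType) (A : set I) (F : I -> ncseries K) :
  ncseries K := fun w => \sum_(i \in A) F i w.

Definition summable (I : choiceType) (A : set I) (F : I -> ncseries K) :=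
  forall w, finite_set (A `&` [set i | F i w != 0]).

Definition stabilizes_to (u : nat -> ncseries K) R :=
  forall w, exists N, forall n, (N <= n)%N -> u n w = R w.

Definition nclim (u : nat -> ncseries K) : ncseries K :=
  xget 0 [set R | stabilizes_to u R].

Lemma nclimP u R : stabilizes_to u R -> nclim u = R.
Proof.
move=> uR; apply: xget_unique => // S uS; apply/funext => w.
have [[M HM] [N HN]] := (uR w, uS w).
by rewrite -(HM (maxn M N)) ?leq_maxl // -(HN (maxn M N)) ?leq_maxr.
Qed.

(* On words: each letter i of a word of S becomes i.+1, so the new word has no
   letter 0. *)
Definition shift S : ncseries K :=
  fun w => if all (ltn 0) w then S (map predn w) else 0.

Lemma shift_var k : shift (ncvar k) = ncvar k.+1.
Proof.
apply/funext => w; rewrite /shift /ncvar.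
by case: w => [|[|x] [|y w]] //=; rewrite !eqseq_cons ?andbF //; case: ifP.
Qed.

Lemma shift_is_linear : linear shift.
Proof.
move=> a R S; apply/funext => w; rewrite ncDE ncZE /shift.
by case: ifP => // _; rewrite mulr0 addr0.
Qed.

HB.instance Definition _ :=
  GRing.isLinear.Build K (ncseries K) (ncseries K) _ shift shift_is_linear.

Lemma shift_is_monoid_morphism : monoid_morphism shift.
Proof.
split.
  by apply/funext => w; rewrite /shift !nc1E; case: w => [|x w] //=; case: ifP.
move=> R S; apply/funext => w; rewrite [RHS]ncME /shift.
have wE i : all (ltn 0) w = all (ltn 0) (take i w) && all (ltn 0) (drop i w).
  by rewrite -all_cat cat_take_drop.
case: ifP => [w_gt0|wN]; last first.
  symmetry; apply: big1 => i _; move: wN; rewrite (wE i).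
  by case: (all _ (take i w)) => [/= ->|_]; rewrite ?mulr0 ?mul0r.
rewrite ncME size_map; apply: eq_bigr => i _.
by move: w_gt0; rewrite (wE i) map_take map_drop => /andP[-> ->].
Qed.

HB.instance Definition _ := GRing.isMonoidMorphism.Build
  (ncseries K) (ncseries K) shift shift_is_monoid_morphism.

(* Intended for S with zero constant term, where the family is summable. *)
Definition plethysm R S : ncseries K :=
  ncsum setT (fun kappa => R kappa *: \prod_(k <- kappa) iter k shift S).

Definition agree (n : nat) R S := forall w, (size w <= n)%N -> R w = S w.

Lemma agreeM n R R' S S' :
  agree n R R' -> agree n S S' -> agree n (R * S) (R' * S').
Proof.
move=> RR' SS' w wn; rewrite !ncME; apply: eq_bigr => i _; rewrite RR' ?SS' //.
  by rewrite size_drop (leq_trans (leq_subr _ _)).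
by rewrite size_take_min (leq_trans (geq_minr _ _)).
Qed.

Lemma agree_iter_shift n k S S' :
  agree n S S' -> agree n (iter k shift S) (iter k shift S').
Proof.
move=> SS'; elim: k => [//|k IH] w wn /=; rewrite /shift.
by case: ifP => // _; rewrite IH ?size_map.
Qed.

Lemma agree_plethysm n R S S' :
  agree n S S' -> agree n (plethysm R S) (plethysm R S').
Proof.
move=> SS' w wn; apply: eq_fsbigr => kappa _; rewrite !ncZE; congr (_ * _).
elim: kappa w wn => [|k kappa IH] w wn; first by rewrite !big_nil.
by rewrite !big_cons; apply: (agreeM _ IH) => //; exact: agree_iter_shift.
Qed.

Lemma iter_shift_support k S w :
  S [::] = 0 -> iter k shift S w != 0 -> w != [::] /\ all (leq k) w.
Proof.
move=> S0; elim: k w => [|k IH] w /=.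
  by case: w => [|x w]; rewrite ?S0 ?eqxx // => _; split=> //; apply/allP.
rewrite /shift; case: ifP => [w_gt0 /IH[wN kw]|]; last by rewrite eqxx.
split; first by case: w wN {w_gt0 kw}.
apply/allP => x xw; move/allP/(_ x xw): w_gt0 => /= x_gt0.
by move: kw; rewrite all_map => /allP/(_ x xw) /=; case: x x_gt0 {xw}.
Qed.

Lemma prod_shift_support S kappa w : S [::] = 0 ->
  (\prod_(k <- kappa) iter k shift S) w != 0 ->
  (size kappa <= size w)%N /\ all (leq^~ (sumn w)) kappa.
Proof.
move=> S0; elim: kappa w => [//|k kappa IH] w; rewrite big_cons ncME => neq0.
have [i neq] : exists i : 'I_(size w).+1, (iter k shift S) (take i w) *
    (\prod_(j <- kappa) iter j shift S) (drop i w) != 0.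
  apply/existsP; rewrite -negb_forall; apply: contraNN neq0 => /forallP h.
  by rewrite big1 // => i _; apply/eqP.
have [/(iter_shift_support S0)[tN kt] /IH[sz le]] :
    (iter k shift S) (take i w) != 0 /\
    (\prod_(j <- kappa) iter j shift S) (drop i w) != 0.
  by apply/andP; rewrite -negb_or -mulf_eq0.
have -> : size w = (size (take i w) + size (drop i w))%N.
  by rewrite -size_cat cat_take_drop.
have -> : sumn w = (sumn (take i w) + sumn (drop i w))%N.
  by rewrite -sumn_cat cat_take_drop.
case: (take i w) tN kt => [//|x t] _ /= /andP[kx _]; split.
  by rewrite addSn ltnS (leq_trans sz) // leq_addl.
rewrite -addnA (leq_trans kx) ?leq_addr //=.
by apply: sub_all le => j /= /leq_trans; apply; rewrite addnA leq_addl.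
Qed.

Fixpoint bounded_words (b n : nat) : seq (seq nat) :=
  if n is n'.+1 then
    [::] :: [seq x :: w | x <- iota 0 b.+1, w <- bounded_words b n']
  else [:: [::]].

Lemma mem_bounded_words b n w :
  (size w <= n)%N -> all (leq^~ b) w -> w \in bounded_words b n.
Proof.
elim: n w => [|n IH] [|x w] //= wn /andP[xb wb].
rewrite inE /=; apply: (@allpairs_f _ _ _ (fun x w => x :: w) (iota 0 b.+1)).
  by rewrite mem_iota add0n ltnS.
exact: IH.
Qed.

Lemma plethysm_summable R S : S [::] = 0 ->
  summable setT (fun kappa => R kappa *: \prod_(k <- kappa) iter k shift S).
Proof.
move=> S0 w.
apply: (@sub_finite_set _ _ [set` bounded_words (sumn w) (size w)]); last first.
  exact: finite_seq.
move=> kappa [_ /=]; rewrite ncZE mulf_eq0 negb_or => /andP[_].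
by move=> /(prod_shift_support S0)[sz le]; exact: mem_bounded_words.
Qed.

Lemma ncgeom_inv i :
  (1 - ncvar i)^-1 = (fun w => (all (pred1 i) w)%:R) :> ncseries K.
Proof.
set G : ncseries K := fun w => _.
have GS x w : G (x :: w) = (x == i)%:R * G w by rewrite /G /= -mulnb natrM.
have H1 : (1 - ncvar i) * G = 1.
  rewrite mulrBl mul1r; apply/funext => -[|x w]; rewrite ncDE ncNE nc1E.
    by rewrite ncvarM_nil subr0.
  by rewrite ncvarM_cons GS subrr.
have H2 : G * (1 - ncvar i) = 1.
  rewrite mulrBr mulr1; apply/funext; elim=> [|x w IH].
    by rewrite ncDE ncNE ncM_nil /ncvar mulr0 subr0.
  have dG : nc_deriv x G = (x == i)%:R *: G.
    by apply/funext => v; rewrite /nc_deriv GS.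
  move: IH; rewrite !ncDE !ncNE [(G * _) (x :: w)]nc_mul_cons dG.
  rewrite -[nc_mul _ _]/((_ *: G) * ncvar i) -scalerAl ncZE GS nc1E => IH.
  rewrite {2}/G /= mul1r opprD addrCA -mulrBr IH nc1E {1}/ncvar eqseq_cons.
  by rewrite -natrM mulnb addNr.
have uG : (1 - ncvar i : ncseries K) \is a GRing.unit.
  by apply/unitrP; exists G.
by apply: (mulrI uG); rewrite divrr.
Qed.

End Series.

Arguments ncvar {K} k.
Arguments ncword {K} kappa.

Notation "''X_' k" := (ncvar k)
  (at level 8, k at level 2, format "''X_' k") : ring_scope.
Notation "R '\os' S" := (plethysm R S) (at level 40) : ring_scope.

Definition composition : pred (seq nat) := all (ltn 0).

Definition cyclic_composition (kappa : seq nat) : bool :=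
  composition kappa && (if kappa is k :: s then all (ltn k) s else false).

Definition differences_le (m : nat) : pred (seq nat) :=
  sorted (fun a b => b <= a + m)%N.

Section MainSeries.
Variable K : fieldType.

Definition Cseries (m : nat) : ncseries K :=
  ncsum [set kappa | composition kappa /\ differences_le m kappa] ncword.

Definition Pibar (m : nat) : ncseries K :=
  \prod_(i <- rev (iota 1 m)) (1 - 'X_i)^-1.

Definition Pibar_inf : ncseries K := nclim Pibar.

Definition is_enriched_series (R A : ncseries K) : Prop :=
  A [::] = 0 /\ A = 'X_0 * (R \os A).

Definition Aseries (R : ncseries K) : ncseries K :=
  xget 0 [set A | is_enriched_series R A].

Definition partition_le (m : nat) : pred (seq nat) :=
  fun w => sorted geq w && all (fun i => 1 <= i <= m)%N w.

Lemma PibarS m : Pibar m.+1 = (1 - 'X_m.+1)^-1 * Pibar m.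
Proof.
have iS : iota 1 m.+1 = iota 1 m ++ [:: m.+1] by rewrite -{1}[m.+1]addn1 iotaD add1n.
by rewrite /Pibar iS rev_cat big_cons.
Qed.

Lemma PibarE m w : Pibar m w = (partition_le m w)%:R.
Proof.
have geq_trans : transitive geq by move=> ? ? ? ? /leq_trans; apply.
elim: m w => [|m IH] w.
  rewrite /Pibar big_nil nc1E /partition_le; case: w => [//|[|x] w] /=;
  by rewrite ?andbF.
rewrite PibarS ncgeom_inv; set G : ncseries K := fun _ => _.
elim: w => [|x w IHw]; first by rewrite ncM_nil IH /G mul1r.
have dG : nc_deriv x G = (x == m.+1)%:R *: G.
  by apply/funext => v; rewrite /nc_deriv /G /= -mulnb natrM.
rewrite [LHS]nc_mul_cons dG -[nc_mul _ _]/((_ *: G) * Pibar m) -scalerAl ncZE.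
rewrite IHw {1}/G /= mul1r IH /partition_le /= !(path_sortedE geq_trans).
case: eqP => [->|/eqP xm].
  rewrite ltnn !(andbF, andFb) add0r mul1r ltn0Sn leqnn /=; congr _%:R.
  case: (sorted _ _); rewrite ?andbF //= andbT -all_predI.
  by congr nat_of_bool; apply: eq_all => y /=; case: (y <= m.+1)%N; rewrite ?andbF.
rewrite mul0r addr0 (leq_eqVlt x m.+1) (negbTE xm) /= ltnS; congr _%:R.
case xl: (x <= m)%N; rewrite ?andbF //.
case sw: (all (geq x) w) => //=; congr nat_of_bool; congr (_ && (_ && _)).
apply: eq_in_all => y /(allP sw) /= yx.
by rewrite (leq_trans yx xl) (leq_trans yx (leqW xl)).
Qed.

Lemma Pibar_infE w : Pibar_inf w = (sorted geq w && composition w)%:R.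
Proof.
rewrite /Pibar_inf (@nclimP _ _ (fun w => (sorted geq w && composition w)%:R)) //.
move=> v; exists (sumn v) => n vn; rewrite PibarE; congr (_ (_ && _))%:R.
apply: eq_in_all => i iv; rewrite (leq_trans _ vn) ?andbT //.
by elim: v iv {vn} => //= x v IHv; rewrite inE => /orP[/eqP->|/IHv h];
  rewrite ?leq_addr // (leq_trans h) ?leq_addl.
Qed.

Lemma enriched_series_agree R A B n :
  is_enriched_series R A -> is_enriched_series R B -> agree n A B.
Proof.
move=> [A0 eA] [B0 eB]; elim: n => [|n IH] [|x w] //; rewrite ?A0 ?B0 // => wn.
by rewrite eA eB !ncvarM_cons (agree_plethysm _ IH).
Qed.

Lemma enriched_series_exists R : exists A, is_enriched_series R A.
Proof.
pose Phi (A : ncseries K) := 'X_0 * (R \os A).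
pose u n := iter n Phi 0.
have u_agree n : agree n (u n) (u n.+1).
  elim: n => [|n IH] [|x w] //= wn; rewrite /Phi ?ncvarM_nil //.
  by rewrite !ncvarM_cons (agree_plethysm _ IH).
have u_agreeD n p : agree n (u n) (u (n + p)%N).
  elim: p => [|p IH] w wn; rewrite ?addn0 // addnS IH //.
  by apply: u_agree; rewrite (leq_trans wn) ?leq_addr.
exists (fun w => u (size w) w); split=> //; apply/funext => -[|x w].
  by rewrite ncvarM_nil.
rewrite ncvarM_cons [LHS]ncvarM_cons; congr (_ * _).
apply: (@agree_plethysm _ (size w)) => // v vw.
by have := u_agreeD _ (size w - size v)%N v (leqnn _); rewrite subnKC.
Qed.

Lemma AseriesP R : is_enriched_series R (Aseries R).
Proof. exact: xgetPex (enriched_series_exists R). Qed.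

Lemma Aseries_unique R A : is_enriched_series R A -> A = Aseries R.
Proof.
move=> eA; apply/funext => w.
exact: (enriched_series_agree eA (AseriesP R)) (leqnn _).
Qed.

End MainSeries.

Arguments Cseries {K} m.
Arguments Pibar {K} m.
Arguments Pibar_inf {K}.

Inductive tree : Type := Node of nat & seq tree.

HB.instance Definition _ := gen_eqMixin tree.
HB.instance Definition _ := gen_choiceMixin tree.

Definition color (t : tree) : nat := let: Node c _ := t in c.

Fixpoint preorder (t : tree) : seq nat :=
  let: Node c ts := t in c :: flatten (map preorder ts).

(* Truncated subtraction is harmless: differences are required to be positive,
   so a child of color at most c is rejected. *)
Fixpoint enriched (m : nat) (t : tree) : bool :=
  let: Node c ts := t in
  let ds := [seq color u - c | u <- ts]%N in
  [&& sorted geq ds, all (fun d => 1 <= d <= m)%N ds & all (enriched m) ts].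

(* Going down to the last child first makes the attachment point the vertex
   closest to the leaf among those of label < a on the rightmost branch; the
   result is None if there is no such vertex. *)
Fixpoint attach (a : nat) (t : tree) : option tree :=
  let: Node c ts := t in
  if last None (map (attach a) ts) is Some u
  then Some (Node c (rcons (take (size ts).-1 ts) u))
  else if (c < a)%N then Some (Node c (rcons ts (Node a [::]))) else None.

(* The values on sequences that are not cyclic compositions are irrelevant. *)
Definition insertion (kappa : seq nat) : tree :=
  if kappa is k :: s
  then foldl (fun t a => odflt t (attach a t)) (Node k [::]) s
  else Node 0 [::].

(* Main.v *)
Require Import Defs.
From mathcomp Require Import all_boot all_order all_algebra.
From mathcomp Require Import boolp classical_sets functions cardinality fsbigop.
From mathcomp Require Import zify.

(** Reading an enriched tree in preorder, the color goes up by at most [m] at a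
    step to a child and does not go up at a step to a sibling of an ancestor;
    this makes preorder a two-sided inverse of the insertion.  On the series
    side, a word whose differences are at most [m] factors uniquely into cyclic
    words with weakly decreasing first letters: the cuts are at its weak
    left-to-right minima.  Hence composing a series [R] supported on weakly
    decreasing words with the series of the cyclic words evaluates [R] at the
    sequence of minima.  For [R = Pibar m] this shows that the series of the
    cyclic words starting with 0 solves the equation defining
    [Aseries (Pibar m)], and for [R = Pibar_inf] it gives [Cseries m]. *)

Import GRing.Theory.
Local Open Scope classical_set_scope.
Local Open Scope ring_scope.

Set Implicit Arguments.
Unset Strict Implicit.
Unset Printing Implicit Defensive.

(** * Enriched trees, preorder and attachment *)

(** Children sit inside a list; an inner fixpoint over that list supplies the hypothesis for each of
    them. *)
Lemma tree_nested_ind (P : tree -> Prop) :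
  (forall c ts, (forall u, u \in ts -> P u) -> P (Node c ts)) ->
  forall t, P t.
Proof.
move=> PN.
have Pnil u : u \in [::] -> P u by [].
have Pcons v ts : P v -> (forall u, u \in ts -> P u) ->
    forall u, u \in v :: ts -> P u.
  by move=> Pv Pts u; rewrite inE => /orP[/eqP ->|/Pts].
refine (fix IH t : P t := let: Node c ts := t in PN c ts
  ((fix IHs us : forall u, u \in us -> P u :=
      if us is v :: us' then Pcons v us' (IH v) (IHs us') else Pnil) ts)).
Qed.

(** Once the differences are positive no subtraction is truncated, so comparing differences amounts
    to comparing colors. *)
Lemma enrichedE m c ts : enriched m (Node c ts) =
  [&& sorted geq (map color ts),
      all (fun u => (c < color u) && (color u <= c + m))%N ts
    & all (enriched m) ts].
Proof.
rewrite /= all_map.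
have -> : all (preim (fun u => color u - c)%N (fun d => 1 <= d <= m)%N) ts =
    all (fun u => (c < color u) && (color u <= c + m))%N ts.
  by apply: eq_all => u /=; lia.
case: allP => [cts|//]; rewrite ?andbF //.
rewrite !sorted_map; congr (_ && _).
apply: (@eq_in_sorted _ (mem ts)); last exact/allP.
by move=> u v /cts/andP[cu _] /cts/andP[cv _] /=; lia.
Qed.

Lemma attach_nil a c : attach a (Node c [::]) =
  if (c < a)%N then Some (Node c [:: Node a [::]]) else None.
Proof. by []. Qed.

Lemma attach_rcons a c ts v : attach a (Node c (rcons ts v)) =
  if attach a v is Some u then Some (Node c (rcons ts u))
  else if (c < a)%N then Some (Node c (rcons (rcons ts v) (Node a [::])))
  else None.
Proof.
by rewrite /= map_rcons last_rcons size_rcons -cats1 take_size_cat.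
Qed.

(** Colors strictly increase from parent to child, so no vertex of the rightmost branch has a color
    below [a]. *)
Lemma attach_None m a t : enriched m t -> (a <= color t)%N -> attach a t = None.
Proof.
elim/tree_nested_ind: t => c ts; case/lastP: ts => [|ts v] IH; rewrite [color _]/=.
  by rewrite attach_nil ltnNge => _ ->.
rewrite enrichedE !all_rcons -!andbA => /and5P[_ cv _ _ /andP[ev _]] ac.
rewrite attach_rcons IH ?mem_rcons ?mem_head ?ltnNge ?ac //.
by apply: leq_trans ac (ltnW _).
Qed.

Lemma attach_Some a t : (color t < a)%N ->
  exists2 u, attach a t = Some u & color u = color t.
Proof.
case: t => c ts; case/lastP: ts => [|ts v]; rewrite [color _]/= => ca.
  by rewrite attach_nil ca; eexists.
by rewrite attach_rcons ca; case: (attach a v) => [u|]; eexists.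
Qed.

Lemma preorder_head t : preorder t = color t :: behead (preorder t).
Proof. by case: t. Qed.

Lemma attach_preorder a t u :
  attach a t = Some u -> preorder u = rcons (preorder t) a.
Proof.
elim/tree_nested_ind: t u => c ts; case/lastP: ts => [|ts v] IH u.
  by rewrite attach_nil; case: ifP => // _ [<-].
rewrite attach_rcons; case e: (attach a v) => [w|].
  move=> [<-] /=; rewrite !map_rcons !flatten_rcons (IH v _ w e).
    by rewrite rcons_cat.
  by rewrite mem_rcons mem_head.
case: ifP => // _ [<-] /=.
by rewrite [in LHS]map_rcons flatten_rcons /= cats1.
Qed.

Lemma preorder_enriched m t : enriched m t ->
  all (ltn (color t)) (behead (preorder t)) /\ differences_le m (preorder t).
Proof.
elim/tree_nested_ind: t => c ts IH; rewrite enrichedE => /and3P[sts cts ets].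
rewrite /differences_le /=.
have {cts ets}: forall u, u \in ts -> [/\ (c < color u)%N,
   (color u <= c + m)%N, all (ltn (color u)) (behead (preorder u))
   & differences_le m (preorder u)].
  move=> u uts; have /andP[cu uc] := allP cts u uts.
  by have [] := IH u uts (allP ets u uts).
move=> {IH} IH; split.
  apply/allP => x /flatten_mapP[u uts].
  have [cu _ /allP ltu _] := IH u uts.
  by rewrite preorder_head inE => /orP[/eqP->//|/ltu/= ?]; apply: ltn_trans cu _.
have : if ts is u :: _ then (color u <= c + m)%N else true.
  by case: ts sts IH => [//|u ts] _ /(_ u (mem_head _ _))[].
(* The start of the path becomes an arbitrary [y], the last color read so far; it equals [c] only
   before the first child. *)
move: {1 2}c; elim: ts sts IH => [//|u ts IHts] /= sts IH y uy.
have [cu uc ltu du] := IH u (mem_head _ _).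
rewrite cat_path; apply/andP; split.
  by move: du; rewrite preorder_head /differences_le /= uy.
apply: IHts; first exact: path_sorted sts.
  by move=> v vts; apply: IH; rewrite inE vts orbT.
(* The next sibling [v] satisfies [color v <= color u], and no vertex below [u] has a color under
   that of [u]. *)
case: ts sts {IH} => [//|v ts] /= /andP[/= vu _].
rewrite preorder_head /=; apply: leq_trans vu (leq_trans _ (leq_addr _ _)).
have: last (color u) (behead (preorder u)) \in
    color u :: behead (preorder u) by exact: mem_last.
by rewrite inE => /orP[/eqP->//|/(allP ltu)/ltnW].
Qed.

(** The upper bound on [a] is consumed at a leaf. Otherwise either [a] enters the last subtree,
    which ends with the same letter as [t], or it is at most the color of the last child and
    inherits the bound of that child. *)
Lemma attach_enriched m a t : enriched m t -> (color t < a)%N ->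
    (a <= last (color t) (behead (preorder t)) + m)%N ->
  exists u, [/\ attach a t = Some u, enriched m u & color u = color t].
Proof.
elim/tree_nested_ind: t => c ts; case/lastP: ts => [|ts v] IH; rewrite [color _]/=.
  move=> _ ca al; rewrite attach_nil ca; eexists; split=> //.
  by rewrite enrichedE /= ca al.
rewrite enrichedE => /and3P[sts cts ets] ca.
have [cv ev] : (c < color v <= c + m)%N /\ enriched m v.
  by move: cts ets; rewrite !all_rcons => /andP[? _] /andP[? _].
have [va|av] := ltnP (color v) a.
  rewrite [behead _]/= map_rcons flatten_rcons last_cat preorder_head [last _ _]/= => al.
  have [|u [au eu cu]] := IH v _ ev va al; first by rewrite mem_rcons mem_head.
  exists (Node c (rcons ts u)); split=> //; first by rewrite attach_rcons au.
  move: sts cts ets; rewrite enrichedE !map_rcons !all_rcons cu.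
  by move=> -> -> /andP[_ ->]; rewrite eu.
move=> _; rewrite attach_rcons (attach_None ev av) ca; eexists; split=> //.
rewrite enrichedE all_rcons cts all_rcons ets /= ca !andbT.
case/andP: cv => _ cv; rewrite (leq_trans av cv) andbT.
move: sts; rewrite !map_rcons; case: (map color ts) => [|b s] /=.
  by rewrite av.
by rewrite andbT [in X in _ -> X]rcons_path last_rcons => -> /=.
Qed.

(** * Insertion and preorder as mutual inverses *)

Definition attached (t : tree) (a : nat) : tree := odflt t (attach a t).

Lemma insertion_cons k s : insertion (k :: s) = foldl attached (Node k [::]) s.
Proof. by []. Qed.

(** Induction on the right end: the tree built so far has preorder word [k :: s], so its last letter
    is the one that the difference condition compares with the new letter. *)
Lemma insertion_enriched m k s : all (ltn k) s -> differences_le m (k :: s) ->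
  [/\ enriched m (insertion (k :: s)), color (insertion (k :: s)) = k
    & preorder (insertion (k :: s)) = k :: s].
Proof.
elim/last_ind: s => [//|s a IH]; rewrite all_rcons /differences_le /= rcons_path.
move=> /andP[/= ka ks] /andP[ds al]; have [et ct pt] := IH ks ds.
have pt' : behead (preorder (insertion (k :: s))) = s by rewrite pt.
have := @attach_enriched m a _ et; rewrite ct pt' => /(_ ka al)[u [au eu cu]].
rewrite -[foldl _ _ _]/(insertion (k :: rcons s a)) insertion_cons foldl_rcons.
rewrite -insertion_cons /attached au /=; split=> //.
by rewrite (attach_preorder au) pt.
Qed.

(** The root of the last subtree keeps its color and can take each of these letters, so none of them
    reaches [c]. *)
Lemma foldl_attached_last c ts v s : all (ltn (color v)) s ->
  foldl attached (Node c (rcons ts v)) s =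
  Node c (rcons ts (foldl attached v s)).
Proof.
elim: s v => [//|a s IH] v /= /andP[va vs].
have [u au cu] := attach_Some va.
by rewrite {2 4}/attached attach_rcons au /= IH // cu.
Qed.

Lemma insertion_preorder m t : enriched m t -> insertion (preorder t) = t.
Proof.
elim/tree_nested_ind: t => c us IH; rewrite enrichedE => /and3P[sus cus eus].
rewrite [preorder _]/= insertion_cons.
(* The children [ts] are already rebuilt and [vs] remain to be read; the last hypothesis says that
   the root of the next child is attached directly under [c]. *)
suff H : forall vs ts, (forall u, u \in vs -> insertion (preorder u) = u) ->
    sorted geq (map color vs) -> all (fun u => c < color u)%N vs ->
    all (enriched m) vs ->
    (if vs is u :: _ then attach (color u) (Node c ts) =
       Some (Node c (rcons ts (Node (color u) [::]))) else True) ->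
    foldl attached (Node c ts) (flatten (map preorder vs)) = Node c (ts ++ vs).
  apply: (H us [::]) => //.
  - by move=> u uus; apply: IH => //; exact: (allP eus).
  - by apply: sub_all cus => u /andP[].
  - by case: us cus {H IH sus eus} => [//|u us] /= /andP[/andP[cu _] _]; rewrite cu.
elim=> [|u vs IHvs] ts Hvs svs cvs evs att; first by rewrite cats0.
case/andP: cvs => cu cvs; case/andP: evs => eu evs.
have [ltu _] := preorder_enriched eu.
rewrite [flatten _]/= foldl_cat preorder_head [foldl _ _ (_ :: _)]/=.
rewrite [attached (Node c ts) _]/attached att [odflt _ _]/=.
rewrite foldl_attached_last // -insertion_cons -preorder_head.
rewrite (Hvs u (mem_head _ _)) -cat_rcons; apply: IHvs => //.
- by move=> v vvs; apply: Hvs; rewrite inE vvs orbT.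
- exact: path_sorted svs.
(* The color of [v] is at most that of [u], so [u] rejects it and it goes to the root. *)
case: vs svs cvs {evs Hvs} => [//|v vs] /andP[vu _] /andP[cv _].
by rewrite attach_rcons (attach_None eu vu) cv.
Qed.

(** * Weak left-to-right minima of a word *)

(* The weak left-to-right minima of [w] that are at most [k]. *)
Fixpoint minima_le (k : nat) (w : seq nat) : seq nat :=
  if w is x :: w' then
    if (x <= k)%N then x :: minima_le x w' else minima_le k w'
  else [::].

Definition minima (w : seq nat) : seq nat :=
  if w is x :: w' then x :: minima_le x w' else [::].

Lemma path_minima_le k w : path geq k (minima_le k w).
Proof. by elim: w k => [//|x w IH] k /=; case: leqP => [xk|_] /=; rewrite ?xk IH. Qed.

Lemma sorted_minima w : sorted geq (minima w).
Proof. by case: w => [//|x w]; exact: path_minima_le. Qed.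

(** A letter 0 lies below every bound, so it is never dropped. *)
Lemma composition_minima_le k w : (0 < k)%N ->
  composition (minima_le k w) = composition w.
Proof.
elim: w k => [//|x w IH] k k0 /=; case: (leqP x k) => [_|kx] /=.
  by case: x => [//|x] /=; exact: IH.
by rewrite IH // (leq_ltn_trans _ kx).
Qed.

Lemma composition_minima w : composition (minima w) = composition w.
Proof. by case: w => [//|[//|x] w] /=; apply: composition_minima_le. Qed.

(** * Series of cyclic words and factorization at the minima *)

Section CyclicSeries.
Variables (K : fieldType) (m : nat).

Definition cyclic_series (k : nat) : ncseries K := fun w =>
  if w is x :: s then [&& x == k, all (ltn k) s & differences_le m w]%:R else 0.

(* The words that may follow a letter [y] in a cyclic word starting with [k]. *)
Definition cyclic_tail (k y : nat) : ncseries K := fun s =>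
  (all (ltn k) s && path (fun a b => b <= a + m)%N y s)%:R.

Lemma cyclic_seriesE k : cyclic_series k = 'X_k * cyclic_tail k k.
Proof.
apply/funext => -[|x s]; first by rewrite ncvarM_nil.
rewrite ncvarM_cons /cyclic_series /cyclic_tail -natrM mulnb.
by case: eqP => [->|].
Qed.

(** The conditions only compare letters, and the words on the right contain no 0, so lowering every
    letter by one loses nothing. *)
Lemma shift_cyclic_series k : shift (cyclic_series k) = cyclic_series k.+1.
Proof.
apply/funext => -[|x s] //; rewrite /shift /cyclic_series.
have [/= /andP[x0 s0]|/negP sN] := boolP (all (ltn 0) (x :: s)); last first.
  case: and3P => // -[/eqP xk ks _]; case: sN; rewrite xk /=.
  by apply: sub_all ks => y; exact: leq_ltn_trans.
case: x x0 => [//|x] _ /=; rewrite eqSS; congr (_ && _)%:R.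
rewrite /differences_le /= all_map -[x]/(x.+1.-1) path_map /=; congr (_ && _).
  by apply: eq_in_all => y /(allP s0) /=; lia.
have xs0 : all (ltn 0) (x.+1 :: s) by [].
by apply: (eq_in_path _ xs0) => -[|a] [|b].
Qed.

Lemma iter_shift_cyclic_series k : iter k (@shift K) (cyclic_series 0) = cyclic_series k.
Proof. by elim: k => [//|k IH]; rewrite iterS IH shift_cyclic_series. Qed.

(** The place of the cut is forced: the tail must stop before a letter [z <= k], and must go on
    through [z > k] because [P] vanishes on words starting with such a [z]. *)
Lemma cyclic_tailM k y (P : ncseries K) kappa w :
    (k <= y)%N -> path geq k kappa ->
    (forall v, P v = ((minima v == kappa) && differences_le m v)%:R) ->
  (cyclic_tail k y * P) w = ((minima_le k w == kappa) &&
     path (fun a b => b <= a + m)%N y w)%:R.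
Proof.
move=> + kk PE; elim: w y => [|z w IH] y ky.
  by rewrite ncM_nil PE {1}/cyclic_tail /= mul1r.
rewrite [LHS]nc_mul_cons {1}/cyclic_tail /= mul1r PE.
have dE : nc_deriv z (cyclic_tail k y) =
    ((k < z) && (z <= y + m))%N%:R *: cyclic_tail k z.
  apply/funext => s; rewrite ncZE /nc_deriv /cyclic_tail -natrM mulnb /=.
  by rewrite !andbA; congr (_ && _)%:R; rewrite -!andbA; congr (_ && _); rewrite andbC.
rewrite dE -[nc_mul _ _]/((_ *: cyclic_tail k z) * P) -scalerAl ncZE.
have [zk|kz] := leqP z k.
  (* At a cut the difference bound is automatic, as [z <= k <= y]. *)
  by rewrite mul0r addr0 (leq_trans zk (leq_trans ky (leq_addr _ _))).
rewrite IH ?(ltnW kz) //= -natrM mulnb.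
have -> : (z :: minima_le z w == kappa) = false.
  case: kappa kk {PE IH} => [//|x kappa] /= /andP[xk _]; rewrite eqseq_cons.
  by case: eqP => // zx; move: kz; rewrite zx ltnNge xk.
by rewrite add0r andbCA.
Qed.

(** Each factor absorbs the letters up to the next minimum, so a word factors in at most one way and
    every coefficient is 0 or 1. *)
Lemma prod_cyclic_series kappa w : sorted geq kappa ->
  (\prod_(k <- kappa) cyclic_series k) w =
  ((minima w == kappa) && differences_le m w)%:R.
Proof.
elim: kappa w => [|k kappa IH] w sk.
  by rewrite big_nil nc1E; case: w.
rewrite big_cons cyclic_seriesE -mulrA.
case: w => [|x w]; first by rewrite ncvarM_nil.
rewrite ncvarM_cons (cyclic_tailM (kappa := kappa)) //; last first.
  by move=> v; apply: IH; exact: path_sorted sk.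
by rewrite -natrM mulnb /= eqseq_cons andbA; case: eqP => [->|].
Qed.

(** Only [kappa = minima w] can contribute, which collapses the infinite sum to one term. *)
Lemma plethysm_cyclic_series (R : ncseries K) w :
    (forall kappa, ~~ sorted geq kappa -> R kappa = 0) ->
  (R \os cyclic_series 0) w = R (minima w) * (differences_le m w)%:R.
Proof.
move=> R0; rewrite /plethysm /ncsum.
have E kappa : (R kappa *: \prod_(k <- kappa) iter k (@shift K) (cyclic_series 0)) w =
   R kappa * ((minima w == kappa) && differences_le m w)%:R.
  rewrite ncZE; have [sk|/R0->] := boolP (sorted geq kappa); last by rewrite !mul0r.
  rewrite -(prod_cyclic_series _ sk); congr (_ * _ w).
  by apply: eq_bigr => k _; rewrite iter_shift_cyclic_series.
rewrite (eq_fsbigr (fun kappa => R kappa *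
   ((minima w == kappa) && differences_le m w)%:R)); last by move=> ? _; exact: E.
rewrite -(fsbig_widen [set minima w]) ?fsbig_set1 ?eqxx //.
move=> kappa [_ /= /eqP]; rewrite eq_sym => /negbTE ->.
by rewrite mulr0.
Qed.

(** A leading 0 requires of [w] that its letters be positive and its first letter at most [m].
    [Pibar m] requires the same of the minima of [w], the largest of which is that first letter. *)
Lemma Aseries_Pibar : Aseries (Pibar m : ncseries K) = cyclic_series 0.
Proof.
symmetry; apply: Aseries_unique; split=> //; apply/funext => -[|x w].
  by rewrite ncvarM_nil.
rewrite ncvarM_cons plethysm_cyclic_series => [|kappa sN]; last first.
  by rewrite PibarE /partition_le (negbTE sN).
rewrite PibarE /partition_le sorted_minima -!natrM mulnb /cyclic_series; congr _%:R.
rewrite -mulnb; case: eqP => [->|//]; congr (_ * nat_of_bool _)%N.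
case: w => [//|y w]; rewrite /differences_le /= add0n.
rewrite -[all (leq 1) w]/(composition w).
have geq_trans : transitive geq by move=> ? ? ? ? /leq_trans; apply.
case: y => [//|y] /=; rewrite -(@composition_minima_le y.+1) //.
have /(order_path_min geq_trans)/allP yw := path_minima_le y.+1 w.
case: (leqP y.+1 m) => [ym|]; rewrite ?andbF //=; congr (_ && _).
by apply: eq_in_all => i /yw /= iy; rewrite (leq_trans iy ym) andbT.
Qed.

Lemma iter_shift_Aseries k :
  iter k (@shift K) (Aseries (Pibar m : ncseries K)) = cyclic_series k.
Proof. by rewrite Aseries_Pibar iter_shift_cyclic_series. Qed.

(** Since [insertion] inverts [preorder] on enriched trees, only [insertion w] can contribute to the
    coefficient of [w]. *)
Lemma ncsum_preorder k :
  ncsum [set t | enriched m t /\ color t = k]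
    (fun t => ncword (preorder t)) = cyclic_series k.
Proof.
apply/funext => w; rewrite /ncsum.
have [[et ct pt]|wN] := pselect [/\ enriched m (insertion w),
    color (insertion w) = k & preorder (insertion w) = w]; last first.
  rewrite fsbig1; last first.
    move=> t [et ct]; rewrite ncwordE; case: eqP => // wt; case: wN.
    by rewrite wt (insertion_preorder et).
  (* The empty [w] lands here: its insertion is the default [Node 0 [::]], whose word is not
     empty. *)
  case: w wN => [//|x s] wN; rewrite /cyclic_series.
  case: and3P => // -[/eqP xk ks ds]; case: wN; rewrite xk in ds *.
  exact: insertion_enriched ks ds.
rewrite -(fsbig_widen [set insertion w]).
- rewrite fsbig_set1 ncwordE pt eqxx /cyclic_series.
  have [] := preorder_enriched et; have := preorder_head (insertion w).
  by rewrite pt ct => -> /= -> ->; rewrite eqxx.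
- by move=> _ ->.
- move=> t [[et' ct'] /= tw]; rewrite ncwordE; case: eqP => // wt; case: tw.
  by rewrite wt (insertion_preorder et').
Qed.

Lemma CseriesE :
  Cseries m = (fun w => (composition w && differences_le m w)%:R) :> ncseries K.
Proof.
apply/funext => w; rewrite /Cseries /ncsum.
have [wC|/negP wN] := boolP (composition w && differences_le m w).
  rewrite -(fsbig_widen [set w]) ?fsbig_set1 ?ncwordE ?eqxx //.
    by move=> _ ->; exact/andP.
  by move=> v [_ /= vw]; rewrite ncwordE; case: eqP => // wv; case: vw.
rewrite fsbig1 // => v vC; rewrite ncwordE; case: eqP => // wv; case: wN.
by rewrite wv; exact/andP.
Qed.

End CyclicSeries.

(** * The bijection and the series identities *)

Lemma insertion_bij m k : (1 <= k)%N ->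
  set_bij [set kappa | cyclic_composition kappa /\ head 0%N kappa = k
                       /\ differences_le m kappa]
          [set t | enriched m t /\ color t = k]
          insertion.
Proof.
move=> k1.
have ins kappa : [set kappa | cyclic_composition kappa /\ head 0%N kappa = k
    /\ differences_le m kappa] kappa ->
    [/\ enriched m (insertion kappa), color (insertion kappa) = k
      & preorder (insertion kappa) = kappa].
  case: kappa => [[]//|x s] /= [/andP[_ ks] [xk ds]].
  by move: ks ds; rewrite xk; exact: insertion_enriched.
split.
- by move=> kappa /ins[].
- by move=> v w /set_mem/ins[_ _ pv] /set_mem/ins[_ _ pw] vw; rewrite -pv vw pw.
- move=> t [et ct]; exists (preorder t); last exact: insertion_preorder et.
  have [+ dt] := preorder_enriched et; rewrite preorder_head ct => ks.
  split; last by split=> //; rewrite -ct -preorder_head.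
  rewrite /cyclic_composition /= k1 ks andbT.
  by apply: sub_all ks => y; exact: leq_ltn_trans.
Qed.

Unset Implicit Arguments.

Theorem theorem21 (K : fieldType) (char0 : [pchar K] =i pred0)
    (m : nat) (m_ge1 : (1 <= m)%N) :
  (forall k : nat, (1 <= k)%N ->
     set_bij [set kappa | cyclic_composition kappa /\ head 0%N kappa = k
                          /\ differences_le m kappa]
             [set t | enriched m t /\ color t = k]
             insertion
     /\ iter k (@shift K) (Aseries (Pibar m)) =
          ncsum [set t | enriched m t /\ color t = k]
                (fun t => ncword (preorder t)))
  /\ (Cseries m : ncseries K) = Pibar_inf \os Aseries (Pibar m).
Proof.
split=> [k k1|].
  split; first exact: insertion_bij.
  by rewrite iter_shift_Aseries ncsum_preorder.
rewrite Aseries_Pibar CseriesE; apply/funext => w.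
rewrite plethysm_cyclic_series => [|kappa sN].
  (* The minima already decrease weakly, so [Pibar_inf] only tests their positivity, which is that
     of [w]. *)
  by rewrite Pibar_infE sorted_minima composition_minima -natrM mulnb.
by rewrite Pibar_infE (negbTE sN).
Qed.
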